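(* Let $\mathcal F$ be a $k$-dense union-closed family over the universe $[n]$. If there exist subsets $A_1\subsetneq A_2\subsetneq\dots\subsetneq A_r\subsetneq B_r$ of $[n]$ with $A_1,\dots,A_r\in\mathcal F$ and $B_r\notin\mathcal F$, then $r<k$.
   Context: A family $\mathcal F$ of subsets of $[n]$ is union-closed over the universe $[n]$ if $[n]\in\mathcal F$ and $A\cup B\in\mathcal F$ for all $A,B\in\mathcal F$. Convention: the empty set is never a member of any family considered; $2^{[n]}$ denotes the family of all nonempty subsets of $[n]$. The closure of a union-closed $\mathcal F$ is $\overline{\mathcal F}=\{A\in 2^{[n]}:\ \mathcal F\cup\{A\}\text{ is union-closed}\}$; iterated closures are $\overline{\mathcal F}^{(0)}=\mathcal F$, $\overline{\mathcal F}^{(i)}=\overline{\overline{\mathcal F}^{(i-1)}}$. $\mathcal F$ is $k$-dense if $k$ is the smallest nonnegative integer with $\overline{\mathcal F}^{(k)}=2^{[n]}$. *)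

(* Defs.v *)
From mathcomp Require Import all_boot.

Set Implicit Arguments.
Unset Strict Implicit.
Unset Printing Implicit Defensive.

Section UnionClosed.
Variable n : nat.
Implicit Types (F : {set {set 'I_n}}) (A B : {set 'I_n}).

(* The empty set is never a member of a family, so 2^[n] excludes it, and a
   union-closed family is required not to contain it. *)
Definition nonempty_subsets : {set {set 'I_n}} := [set A | A != set0].

Definition union_closed F : bool :=
  [&& set0 \notin F, [set: 'I_n] \in F &
      [forall A in F, forall B in F, A :|: B \in F]].

Definition uc_closure F : {set {set 'I_n}} :=
  [set A in nonempty_subsets | union_closed (F :|: [set A])].

Definition iter_closure (i : nat) F : {set {set 'I_n}} := iter i uc_closure F.

Definition k_dense (k : nat) F : Prop :=
  iter_closure k F = nonempty_subsets /\
  forall j : nat, iter_closure j F = nonempty_subsets -> k <= j.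

End UnionClosed.

(* Main.v *)
Require Import Defs.
From mathcomp Require Import all_boot.
From mathcomp Require Import zify.

(** Induction on the length of the chain, replacing [F] by its closure: given
    [A_1 < ... < A_r < B] with [B] outside [F], pick [x] in [A_r] but not in
    [A_(r-1)].  Then [B :\ x] is not in the closure of [F], because its union
    with [A_r] is [B], while it still properly contains [A_(r-1)].  So the
    closure admits a chain of length [r - 1], and [r] closures never suffice
    to reach all nonempty sets. *)

Lemma union_closedP (n : nat) (F : {set {set 'I_n}}) :
  reflect [/\ set0 \notin F, [set: 'I_n] \in F
            & forall A B, A \in F -> B \in F -> A :|: B \in F]
          (union_closed F).
Proof.
apply: (iffP and3P) => -[F0 FT FU]; split=> //.
  by move=> A B AF BF; move/forall_inP/(_ A AF)/forall_inP: FU; apply.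
by apply/forall_inP => A AF; apply/forall_inP => B BF; apply: FU.
Qed.

(** Adding [A] to [F] creates only the new unions [A :|: C] with [C] in [F]; such a union lies in
    [F] or equals [A], and the latter means [C \subset A]. *)
Lemma uc_closureP (n : nat) (F : {set {set 'I_n}}) (A : {set 'I_n}) :
  union_closed F ->
  reflect (A != set0 /\ forall C, C \in F -> C \subset A \/ A :|: C \in F)
          (A \in uc_closure F).
Proof.
move=> /union_closedP [F0 FT FU]; rewrite !inE.
apply: (iffP andP) => -[A0].
  move=> /union_closedP [_ _ FAU]; split=> // C CF.
  have := FAU A C; rewrite !inE eqxx orbT CF => /(_ isT isT).
  case/orP => [|/eqP/setUidPl]; first by right.
  by left.
move=> AF; split=> //; apply/union_closedP; split; rewrite ?inE ?FT //.
  by rewrite negb_or F0 eq_sym.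
have AU C : C \in F -> A :|: C \in F :|: [set A].
  move=> /AF [/setUidPl ->|]; rewrite !inE ?eqxx ?orbT //.
  by move=> ->.
move=> C D /setUP[CF|/set1P ->] /setUP[DF|/set1P ->].
- by rewrite inE FU.
- by rewrite setUC AU.
- exact: AU.
- by rewrite setUid !inE eqxx orbT.
Qed.

Lemma sub_uc_closure (n : nat) (F : {set {set 'I_n}}) :
  union_closed F -> F \subset uc_closure F.
Proof.
move=> Fuc; have /union_closedP [F0 _ FU] := Fuc.
apply/subsetP => A AF; apply/uc_closureP=> //; split.
  by apply: contraNneq F0 => <-.
by move=> C CF; right; apply: FU.
Qed.

(** Lets the closure be iterated. For [C] in [F] not inside [B], the set [B :|: C] is in [F], so the
    criterion for [A] applies to it. *)
Lemma union_closed_uc_closure (n : nat) (F : {set {set 'I_n}}) :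
  union_closed F -> union_closed (uc_closure F).
Proof.
move=> Fuc; have /union_closedP [F0 FT FU] := Fuc; apply/union_closedP; split.
- by apply/(uc_closureP _ _ _ Fuc) => -[]; rewrite eqxx.
- exact: (subsetP (sub_uc_closure _ _ Fuc)).
move=> A B /(uc_closureP _ _ _ Fuc) [A0 AF] /(uc_closureP _ _ _ Fuc) [B0 BF].
apply/uc_closureP=> //; split; first by rewrite setU_eq0 negb_and A0.
move=> C /BF [CB|/AF []]; first by left; apply: subset_trans CB (subsetUr _ _).
- rewrite subUset => /andP[_ CA]; left.
  exact: subset_trans CA (subsetUl _ _).
- by rewrite setUA; right.
Qed.

(* The chain is indexed from 0 and its top [A r] is the set outside [F]. *)
Lemma iter_closure_chain (n r : nat) (F : {set {set 'I_n}})
    (A : nat -> {set 'I_n}) :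
  union_closed F ->
  (forall i, i < r -> A i \proper A i.+1) ->
  (forall i, i < r -> A i \in F) ->
  A r != set0 -> A r \notin F ->
  iter_closure r F != nonempty_subsets n.
Proof.
elim: r F A => [|r IHr] F A Fuc Achain AF A0 AnF.
  by apply: contraNneq AnF => /= ->; rewrite inE.
have ArF := AF r (ltnSn r).
(* For [r = 0] there is no preceding member to avoid, and any element of the nonempty set [A 0]
   serves. *)
have [x xAr xA] : exists2 x, x \in A r & 0 < r -> x \notin A r.-1.
  case: r Achain ArF {IHr AF A0 AnF} => [|r] Achain ArF.
    have /set0Pn[x xA] : A 0 != set0.
      by case/union_closedP: Fuc => F0 _ _; apply: contraNneq F0 => <-.
    by exists x.
  by have /properP[_ [x xA xnA]] := Achain r (leqnSn _); exists x.
have /properP[sA [y yB ynA]] := Achain r (ltnSn r).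
have yx : y != x by apply: contraNneq ynA => ->.
have yBx : y \in A r.+1 :\ x by rewrite !inE yx.
rewrite /iter_closure iterSr.
(* The new chain drops [A r] and lowers the top by [x]; [y] keeps the last inclusion proper. *)
apply: (IHr _ (fun i => if i < r then A i else A r.+1 :\ x)).
- exact: union_closed_uc_closure.
- move=> i ir; rewrite ir; case: ltnP => [_|ri]; first by apply: Achain; lia.
  have ei : i = r.-1 by lia.
  have r0 : 0 < r by lia.
  have ri1 : i.+1 = r by lia.
  have sAi : A i \subset A r.
    by apply: proper_sub; rewrite -ri1; apply: Achain; lia.
  apply/properP; split.
    by rewrite subsetD1 (subset_trans sAi sA) ei xA.
  by exists y => //; apply: contra ynA => /(subsetP sAi).
- move=> i ir; rewrite ir; apply: (subsetP (sub_uc_closure _ _ Fuc)).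
  by apply: AF; lia.
- by rewrite ltnn; apply/set0Pn; exists y.
(* The criterion fails at [A r]: it contains [x], and its union with the new top is [A r.+1],
   outside [F]. *)
rewrite ltnn; apply/(uc_closureP _ _ _ Fuc) => -[_ /(_ _ ArF)] [].
  by move=> /subsetP /(_ x xAr); rewrite !inE eqxx.
suff -> : A r.+1 :\ x :|: A r = A r.+1 by apply/negP.
apply/setP => z; rewrite !inE; have [->|_] /= := eqVneq z x.
  by rewrite xAr (subsetP sA).
by apply/orb_idr/(subsetP sA).
Qed.

Theorem theorem1 (n k r : nat) (F : {set {set 'I_n}})
    (A : nat -> {set 'I_n}) (B : {set 'I_n})
    (hF : union_closed F) (hk : k_dense k F)
    (hr : 1 <= r)
    (hA : forall i : nat, 1 <= i < r -> A i \proper A i.+1)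
    (hAB : A r \proper B)
    (hAF : forall i : nat, 1 <= i <= r -> A i \in F)
    (hBF : B \notin F) :
  r < k.
Proof.
rewrite ltnNge; apply/negP => kr; have [Fk _] := hk; move/eqP: Fk; apply/negP.
(* If [k <= r], the top [k] members of the chain already give a contradiction. *)
apply: (iter_closure_chain _ _ _
          (fun i => if i < k then A (r - k + i).+1 else B)) => //.
- move=> i ik; rewrite ik; case: ltnP => ki.
    by rewrite addnS; apply: hA; lia.
  (* Here [i] is the last index [k - 1], so the inclusion needed is [A r \proper B]. *)
  by have -> : (r - k + i).+1 = r by lia.
- by move=> i ik; rewrite ik; apply: hAF; lia.
- rewrite ltnn; case/properP: hAB => _ [y yB _].
  by apply/set0Pn; exists y.
- by rewrite ltnn.
Qed.
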